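(* Let $\eta$ and $\eta'$ be nonnegative integer-valued random variables, and let $X$ and $X'$ denote the total number of cars that arrive to the root $\rho$ for the parking process on a Galton-Watson tree (with the same, arbitrary offspring distribution, not necessarily supercritical) with car arrival distributions $\eta$ and $\eta'$, respectively. If $\eta\preceq_{\mathrm{icx}}\eta'$, then $X\preceq_{\mathrm{icx}}X'$.
   Context: Parking process: on a tree $\mathcal T$ with root $\rho$, each vertex has one parking spot. Initially (time $0$) $\eta_v$ cars arrive to each vertex $v$. Cars move towards the root in discrete time, one edge per time step. When a car arrives at an available spot it parks there and the spot becomes unavailable; if several cars arrive at the same available spot simultaneously, one chosen uniformly at random parks there and the others continue towards the root. (This applies also to the cars arriving initially at a vertex.) The total number of cars that ever arrive to $\rho$ includes the $\eta_\rho$ cars initially there and takes values in $\{0,1,\dots\}\cup\{\infty\}$. Parking with car arrival distribution $\eta$ means that the $\eta_v$ are i.i.d. with the law of $\eta$, independent of the tree. Recursion: let $X_n$ be the number of cars arriving to $\rho$ up to time $n$ ($X_0=\eta_\rho$, $X_n\uparrow X$). If $Z$ is the number of children of $\rho$, then $X_{n+1}=\eta_\rho+\sum_{i=1}^Z(X_n^{(i)}-1)^+$, where the $X_n^{(i)}$ are i.i.d. copies of $X_n$ independent of $Z$ and $\eta_\rho$, and $x^+=\max(0,x)$. Increasing convex order: for random variables $U,V$ with values in $[0,\infty]$, $U\preceq_{\mathrm{icx}}V$ means that $E\phi(U)\le E\phi(V)$ for all increasing (nondecreasing) convex functions $\phi:[0,\infty)\to\mathbb R$, where $\phi(\infty):=\lim_{x\to\infty}\phi(x)$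 and the expectations are taken in $(-\infty,\infty]$ (they always exist since $\phi\ge\phi(0)$). *)

(* Defs.v *)
From HB Require Import structures.
From mathcomp Require Import all_boot all_order all_algebra.
From mathcomp Require Import finmap.
From mathcomp Require Import all_classical all_reals all_analysis.

Set Implicit Arguments.
Unset Strict Implicit.
Unset Printing Implicit Defensive.

Import Order.TTheory GRing.Theory Num.Theory.
Import numFieldTopology.Exports.

Local Open Scope classical_set_scope.
Local Open Scope ring_scope.

(* Ulam-Harris labels: the root is [::], and the i-th child of v (counting
   from 0) is rcons v i. *)
Definition vertex : Type := seq nat.

(* In the tree with offspring numbers xi, v is a vertex iff at every step of
   the path from the root to v the child taken exists. *)
Definition tree (xi : vertex -> nat) : pred vertex :=
  fun v => [forall i : 'I_(size v), (nth 0 v i < xi (take i v))%N].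

Definition children (xi : vertex -> nat) (v : vertex) : seq vertex :=
  [seq rcons v i | i <- iota 0 (xi v)].

(* The car (v, k) is the k-th of the cars starting at v. *)
Definition car : Type := (vertex * nat)%type.

(* arriving s v lists the cars arriving to v at the current time, and
   available s v says whether the spot at v was still free just before. *)
Record state : Type := State {
  arriving : vertex -> seq car ;
  available : vertex -> bool }.

(* The cars that do not park at v and move on to the parent of v.  When n.+1
   cars arrive to the available spot at v, the one at position tie v n in the
   list parks.  Since v gets occupied at most once, at most one of the choices
   tie v n, n >= 0, is ever used. *)
Definition departing (tie : vertex -> nat -> nat) (s : state) (v : vertex) :
    seq car :=
  let cs := arriving s v in
  if available s v then
    let k := tie v (size cs).-1 in take k cs ++ drop k.+1 cs
  else cs.

Definition initial (xi eta : vertex -> nat) : state :=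
  State (fun v => if tree xi v then [seq (v, k) | k <- iota 0 (eta v)]
                  else [::])
        (fun=> true).

Definition step (xi : vertex -> nat) (tie : vertex -> nat -> nat)
    (s : state) : state :=
  State (fun v => flatten [seq departing tie s w | w <- children xi v])
        (fun v => available s v && nilp (arriving s v)).

Definition parking (xi eta : vertex -> nat) (tie : vertex -> nat -> nat)
    (t : nat) : state :=
  iter t (step xi tie) (initial xi eta).

(* A car is at any given vertex at most once, so no car is counted twice. *)
Definition total_arrivals (R : realType) (xi eta : vertex -> nat)
    (tie : vertex -> nat -> nat) : \bar R :=
  (\sum_(0 <= t <oo)
    (size (arriving (parking xi eta tie t) [::]))%:R%:E)%E.

Definition mutually_independent (R : realType) (d d' : measure_display)
    (S : measurableType d) (T : measurableType d') (Q : probability S R)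
    (I : choiceType) (Y : I -> {RV Q >-> T}) : Prop :=
  forall (J : {fset I}) (B : I -> set T), (forall i, measurable (B i)) ->
    Q (\bigcap_(i in [set` J]) (Y i @^-1` B i)) =
    (\prod_(i <- J) Q (Y i @^-1` B i))%E.

(* Offspring numbers, numbers of cars and tie-breaking choices are attached to
   all labels, including those outside the random tree. *)
Record gw_parking (R : realType) (d : measure_display) (S : measurableType d)
    (Q : probability S R) (mu nu : probability nat R) : Type := GWParking {
  offspring : vertex -> {RV Q >-> nat} ;
  cars : vertex -> {RV Q >-> nat} ;
  tiebreak : vertex -> nat -> {RV Q >-> nat} ;
  offspring_law : forall v (B : set nat),
    distribution Q (offspring v) B = mu B ;
  cars_law : forall v (B : set nat), distribution Q (cars v) B = nu B ;
  tiebreak_range : forall v n w, (tiebreak v n w <= n)%N ;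
  tiebreak_uniform : forall v n k, (k <= n)%N ->
    distribution Q (tiebreak v n) [set k] = (n.+1%:R^-1)%:E ;
  gw_independent : mutually_independent
    (fun i : (vertex + vertex) + (vertex * nat) =>
       match i with
       | inl (inl v) => offspring v
       | inl (inr v) => cars v
       | inr (v, n) => tiebreak v n
       end) }.

Definition root_arrivals (R : realType) (d : measure_display)
    (S : measurableType d) (Q : probability S R) (mu nu : probability nat R)
    (M : gw_parking Q mu nu) (w : S) : \bar R :=
  total_arrivals R (offspring M ^~ w) (cars M ^~ w)
    (fun v n => tiebreak M v n w).

(* phi is a function on [0, +oo[; its values on negative reals are never used.
   The order is only meant for U, V with values in [0, +oo], so the value of
   the extension at -oo is irrelevant. *)
Definition extend (R : realType) (phi : R -> R) (u : \bar R) : \bar R :=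
  match u with
  | r%:E => (phi r)%:E
  | _ => lim ((phi x)%:E @[x --> +oo%R])
  end.

Definition icx_le (R : realType) (d d' : measure_display)
    (S : measurableType d) (S' : measurableType d')
    (P : probability S R) (P' : probability S' R)
    (U : S -> \bar R) (V : S' -> \bar R) : Prop :=
  forall phi : R -> R,
    {in `[0, +oo[ &, {homo phi : x y / x <= y}} ->
    convex_function (`[0, +oo[%classic : set R) phi ->
    (\int[P]_w extend phi (U w) <= \int[P']_w extend phi (V w))%E.

(* Main.v *)
(* Up to time t the number of cars arriving at v satisfies
   X_0(v) = eta_v and X_{t+1}(v) = eta_v + sum over the children u of
   (X_t(u) - 1)^+, whatever the tie-breaking.  Hence X_t(root) is nondecreasing
   and convex in each single eta_v, the other variables being fixed, and so is
   phi(X_t(root)) for phi increasing and convex; this allows one to replace the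
   law of eta_v by that of eta' at one vertex after the other.  Cutting off the
   offspring numbers at n and the time at n leaves finitely many variables;
   n -> oo follows by monotone convergence. *)

Require Import Defs.
From mathcomp Require Import all_boot all_order all_algebra.
From mathcomp Require Import finmap.
From mathcomp Require Import all_classical all_reals all_analysis.
From mathcomp Require Import measurable_realfun.
From mathcomp Require Import zify ring lra.

Set Implicit Arguments.
Unset Strict Implicit.
Unset Printing Implicit Defensive.

Import Order.TTheory GRing.Theory Num.Theory.

Local Open Scope classical_set_scope.
Local Open Scope ring_scope.

(** * Cumulative arrivals: recursion, truncation, convexity *)

Section Combinatorics.
Local Open Scope nat_scope.
Implicit Types (xi eta : vertex -> nat) (v : vertex).

(** The predecessor on [nat] is the map (x - 1)^+ of the recursion, since [0.-1 = 0]. *)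
Fixpoint arrivals xi eta (t : nat) v : nat :=
  if t is t'.+1 then
    eta v + \sum_(i < xi v) (arrivals xi eta t' (rcons v i)).-1
  else eta v.

Lemma tree_rcons xi v i : tree xi v -> i < xi v -> tree xi (rcons v i).
Proof.
move=> /forallP tv iv; apply/forallP => -[j /=]; rewrite size_rcons => jv.
rewrite nth_rcons -cats1; have [jv'|jv'|->] := ltngtP j (size v).
- by rewrite takel_cat; [exact: (tv (Ordinal jv'))|exact: ltnW].
- by have := leq_trans jv' jv; rewrite ltnn.
- by rewrite takel_cat// take_size.
Qed.

Section parking.
Variables (xi eta : vertex -> nat) (tie : vertex -> nat -> nat).
Hypothesis tie_range : forall v n, tie v n <= n.

Let N s v := size (arriving (parking xi eta tie s) v).
Let D s v := size (departing tie (parking xi eta tie s) v).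

(** By [tie_range] exactly one car of a nonempty list is dropped at an available spot, whichever it
    is. *)
Let DE s v : D s v =
  if available (parking xi eta tie s) v then (N s v).-1 else N s v.
Proof.
rewrite /D /N /departing; case: ifP => // _.
set cs := arriving _ v; have := tie_range v (size cs).-1.
set k := tie v _ => kn.
by rewrite size_cat size_drop size_take; case: ifP; lia.
Qed.

Let N_step s v : N s.+1 v = \sum_(i < xi v) D s (rcons v i).
Proof.
rewrite /N /parking iterS /= size_flatten /shape -map_comp /children -map_comp.
by rewrite sumnE big_map -{1}(subn0 (xi v)) big_mkord.
Qed.

Let availableE s v :
  available (parking xi eta tie s) v = (\sum_(0 <= r < s) N r v == 0).
Proof.
elim: s => [|s IH]; first by rewrite big_geq.
by rewrite /parking iterS /= IH big_nat_recr //= addn_eq0.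
Qed.

(** A vertex retains one car in all, at the first time that any car arrives. *)
Let departures s v :
  \sum_(0 <= r < s) D r v = (\sum_(0 <= r < s) N r v).-1.
Proof.
elim: s => [|s IH]; first by rewrite !big_geq.
rewrite !big_nat_recr //= IH DE availableE.
by case: eqP; lia.
Qed.

(** Later arrivals at [v] are departures of its children one step earlier; exchanging the sums over
    times and children makes [departures] applicable. *)
Lemma parking_arrivals t v : tree xi v ->
  \sum_(0 <= s < t.+1) size (arriving (parking xi eta tie s) v) =
  arrivals xi eta t v.
Proof.
elim: t v => [|t IH] v tv.
  by rewrite big_nat1 /= tv size_map size_iota.
rewrite big_nat_recl // /= tv size_map size_iota; congr addn.
under eq_bigr do rewrite -[size _]/(N _.+1 v) N_step.
rewrite exchange_big /=; apply: eq_bigr => i _.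
by rewrite departures /N IH// tree_rcons.
Qed.

End parking.

Lemma arrivals_monotone xi xi' eta t t' v : (forall u, xi u <= xi' u) ->
  t <= t' -> arrivals xi eta t v <= arrivals xi' eta t' v.
Proof.
move=> le_xi; elim: t t' v => [|t IH] [|t'] v //=; first by rewrite leq_addr.
move=> tt'; rewrite leq_add2l.
rewrite (big_ord_widen _ (fun i => (arrivals xi eta t (rcons v i)).-1) (le_xi v)).
rewrite big_mkcond leq_sum// => i _; case: ifP => // _.
by have := IH t' (rcons v i) tt'; lia.
Qed.

Definition truncate (K : nat) xi v := minn (xi v) K.

Lemma truncate_monotone K K' xi v : K <= K' -> truncate K xi v <= truncate K' xi v.
Proof. by rewrite /truncate; lia. Qed.

Lemma truncate_le K xi v : truncate K xi v <= xi v.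
Proof. exact: geq_minl. Qed.

(** In [t] steps the recursion reads finitely many vertices, so a large cap, depending on [t],
    alters none of their offspring numbers. *)
Lemma arrivals_truncate xi eta t v :
  exists K0, forall K, K0 <= K ->
    arrivals (truncate K xi) eta t v = arrivals xi eta t v.
Proof.
elim: t v => [|t IH] v; first by exists 0.
have [K0 HK0] := choice (fun i => IH (rcons v i)).
exists (maxn (xi v) (\max_(i < xi v) K0 i)) => K; rewrite geq_max => /andP[vK maxK].
rewrite /= /truncate (minn_idPl vK); congr addn; apply: eq_bigr => i _.
rewrite HK0//; apply: leq_trans maxK.
exact: (@leq_bigmax _ (fun j : 'I_(xi v) => K0 j) i).
Qed.

(** A finite list of labels, fixed independently of [xi], that contains all those read by the
    recursion once offspring numbers are capped at [K]. *)
Fixpoint descendants (K t : nat) v : seq vertex :=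
  v :: if t is t'.+1 then flatten [seq descendants K t' (rcons v i) | i <- iota 0 K]
       else [::].

Lemma arrivals_truncate_eq K xi xi' eta eta' t v :
  {in descendants K t v, xi =1 xi'} -> {in descendants K t v, eta =1 eta'} ->
  arrivals (truncate K xi) eta t v = arrivals (truncate K xi') eta' t v.
Proof.
elim: t v => [|t IH] v exi eeta /=; first by rewrite eeta ?mem_head.
have vD : v \in descendants K t.+1 v by rewrite mem_head.
rewrite eeta// /truncate exi//; congr addn; apply: eq_bigr => i _.
have sub : {subset descendants K t (rcons v i) <= descendants K t.+1 v}.
  move=> u uD; rewrite inE; apply/orP; right; apply/flattenP.
  exists (descendants K t (rcons v i)) => //; apply/mapP; exists (nat_of_ord i) => //.
  by rewrite mem_iota add0n (leq_trans (ltn_ord i))// geq_minr.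
congr predn; apply: IH => u /sub; [exact: exi|exact: eeta].
Qed.

(** Monotonicity and nonnegative second differences, written without subtraction in [nat]. *)
Definition discrete_icx (a : nat -> nat) : Prop :=
  forall n, a n <= a n.+1 /\ a n.+1 + a n.+1 <= a n + a n.+2.

(** Sums and the nondecreasing convex map (x - 1)^+ preserve the property. The family [eta n] lets
    one coordinate move while the others stay constant. *)
Lemma discrete_icx_arrivals xi (eta : nat -> vertex -> nat) t v :
  (forall u, discrete_icx (fun n => eta n u)) ->
  discrete_icx (fun n => arrivals xi (eta n) t v).
Proof.
move=> eta_icx; elim: t v => [|t IH] v n; first exact: eta_icx.
have [? ?] := eta_icx v n; split; first rewrite /= leq_add//.
  by apply: leq_sum => i _; have [? _] := IH (rcons v i) n; lia.
rewrite /= addnACA [leqRHS]addnACA leq_add// -!big_split /= leq_sum// => i _.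
by have [? ?] := IH (rcons v i) n; have [? _] := IH (rcons v i) n.+1; lia.
Qed.

End Combinatorics.

(** * Fibres of integer-valued random variables *)

Section NatValued.
Context (R : realType) d (S : measurableType d) (Q : probability S R).
Variable U : {RV Q >-> nat}.
Local Open Scope ereal_scope.

Lemma measurable_fiber n : measurable (U @^-1` [set n]).
Proof. by rewrite -[X in measurable X]setTI; exact: measurable_funPT. Qed.

Lemma integral_fibers (A : set S) (f : S -> \bar R) : measurable A ->
  measurable_fun setT f -> (forall w, 0 <= f w) ->
  \int[Q]_(w in A) f w = \sum_(n <oo) \int[Q]_(w in A `&` U @^-1` [set n]) f w.
Proof.
move=> mA mf f0.
have UT : \bigcup_n (U @^-1` [set n]) = setT.
  by apply/seteqP; split=> // w _; exists (U w).
rewrite -{1}[A]setIT -UT setI_bigcupr ge0_integral_bigcup//.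
- by move=> k; apply: measurableI => //; exact: measurable_fiber.
- exact: measurable_funS mf.
- by apply/trivIsetP => m n _ _ mn; apply/seteqP; split=> // w [[_ /= ->] [_ /= e]];
    move: mn; rewrite e eqxx.
Qed.

Lemma integral_nat_valued (g : nat -> \bar R) : (forall n, 0 <= g n) ->
  \int[Q]_w g (U w) = \sum_(n <oo) Q (U @^-1` [set n]) * g n.
Proof.
move=> g0; rewrite integral_fibers//; last exact: (measurableT_comp (f := g)).
apply: eq_eseriesr => n _; rewrite setTI (eq_integral (cst (g n))).
  by rewrite muleC integral_cst; last exact: measurable_fiber.
by move=> w; rewrite inE /= => ->.
Qed.

End NatValued.

(** * Finitely many independent integer coordinates *)

Section CoordinateLaws.
Context (R : realType) (I : choiceType).
Local Open Scope ereal_scope.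
Implicit Types (l : seq I) (x y : I -> nat) (g : (I -> nat) -> \bar R)
  (lam : I -> nat -> R).

Definition upd y (i : I) (n : nat) : I -> nat :=
  fun j => if j == i then n else y j.

Definition overwrite l x y : I -> nat := fun j => if j \in l then x j else y j.

Lemma overwrite_cons i l x y :
  overwrite (i :: l) x y = overwrite l x (upd y i (x i)).
Proof.
apply/funext => j; rewrite /overwrite /upd inE.
by have [->|_] := eqVneq j i => /=; [rewrite if_same|case: ifP].
Qed.

Lemma updC y i j m n : i != j -> upd (upd y i m) j n = upd (upd y j n) i m.
Proof.
move=> ij; apply/funext => k; rewrite /upd.
by case: (eqVneq k j) => // ->; rewrite eq_sym (negbTE ij).
Qed.

(** The expectation of [g], as an iterated series, when the distinct coordinates in [l] are
    independent with weights [lam] and the others are frozen at [y]. *)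
Fixpoint expect lam l g y : \bar R :=
  if l is i :: l' then \sum_(n <oo) (lam i n)%:E * expect lam l' g (upd y i n)
  else g y.

Lemma expect_ge0 lam l g y : (forall i n, 0 <= lam i n)%R ->
  (forall z, 0 <= g z) -> 0 <= expect lam l g y.
Proof.
move=> lam0 g0; elim: l y => //= i l IH y.
by apply: nneseries_ge0 => n _ _; rewrite mule_ge0 ?lee_fin.
Qed.

(** Tonelli for nonnegative series; updates at distinct coordinates commute. *)
Lemma expect_average lam (c : nat -> R) i l g y : i \notin l ->
  (forall i n, 0 <= lam i n)%R -> (forall n, 0 <= c n)%R ->
  (forall z, 0 <= g z) ->
  \sum_(n <oo) (c n)%:E * expect lam l g (upd y i n) =
  expect lam l (fun z => \sum_(n <oo) (c n)%:E * g (upd z i n)) y.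
Proof.
move=> + lam0 c0 g0; elim: l y => //= j l IH y; rewrite inE negb_or => /andP[ij il].
transitivity (\sum_(n <oo) \sum_(m <oo)
    (c n)%:E * ((lam j m)%:E * expect lam l g (upd (upd y i n) j m))).
  apply: eq_eseriesr => n _; rewrite nneseriesZl// => m _.
  by rewrite mule_ge0 ?lee_fin ?expect_ge0.
rewrite nneseries_interchange; last first.
  by move=> *; rewrite !mule_ge0 ?lee_fin ?expect_ge0.
apply: eq_eseriesr => m _; rewrite -(IH _ il) -nneseriesZl; last first.
  by move=> *; rewrite mule_ge0 ?lee_fin ?expect_ge0.
by apply: eq_eseriesr => n _; rewrite updC// muleCA.
Qed.

(* Exchanging the law of one coordinate at a time: since averages over
   different coordinates commute, the coordinate to be exchanged can be
   averaged first, while the integrand is still g itself. *)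
Lemma expect_le lam lam' l g y : uniq l ->
  (forall i n, 0 <= lam i n)%R -> (forall i n, 0 <= lam' i n)%R ->
  (forall z, 0 <= g z) ->
  (forall i z, i \in l -> \sum_(n <oo) (lam i n)%:E * g (upd z i n) <=
     \sum_(n <oo) (lam' i n)%:E * g (upd z i n)) ->
  expect lam l g y <= expect lam' l g y.
Proof.
move=> + lam0 lam'0 g0; elim: l y => //= i l IH y /andP[il ul] gle.
apply: (@le_trans _ _
    (\sum_(n <oo) (lam i n)%:E * expect lam' l g (upd y i n))).
  apply: lee_nneseries => n *; first by rewrite mule_ge0 ?lee_fin ?expect_ge0.
  rewrite lee_wpmul2l ?lee_fin//; apply: IH => // j z jl.
  by apply: gle; rewrite inE jl orbT.
rewrite !expect_average//.
have mono g1 g2 k z : (forall z, 0 <= g1 z) -> (forall z, g1 z <= g2 z) ->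
    expect lam' k g1 z <= expect lam' k g2 z.
  move=> g10 g12; elim: k z => //= j k IHk z.
  apply: lee_nneseries => n *; first by rewrite mule_ge0 ?lee_fin ?expect_ge0.
  by rewrite lee_wpmul2l ?lee_fin.
apply: mono => z; last by rewrite gle// mem_head.
by apply: nneseries_ge0 => n *; rewrite mule_ge0 ?lee_fin.
Qed.

Context d (S : measurableType d) (Q : probability S R) (Y : I -> {RV Q >-> nat}).

(** Only the finitely many integer coordinates in [l] are random, so countably many fibres suffice
    and [g] is arbitrary. *)
Lemma measurable_overwrite d' (T : measurableType d') l (g : (I -> nat) -> T) y :
  measurable_fun setT (fun w => g (overwrite l (Y ^~ w) y)).
Proof.
elim: l y => [|i l IH] y; first exact: (measurable_cst (g y)).
move=> _ B mB; rewrite setTI.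
rewrite (_ : _ @^-1` _ = \bigcup_n (Y i @^-1` [set n] `&`
    (fun w => g (overwrite l (Y ^~ w) (upd y i n))) @^-1` B)).
  apply: bigcupT_measurable => n; apply: measurableI; first exact: measurable_fiber.
  by rewrite -[X in measurable X]setTI; exact: IH.
apply/seteqP; split => w /=; rewrite overwrite_cons; first by exists (Y i w).
by move=> [n _ [/= ->]].
Qed.

(** The event over [J] collects the coordinates already fixed: each induction step splits along the
    fibres of one more coordinate, which then joins [J]. An empty [J] gives the expectation
    itself. *)
Lemma integral_independent lam (J : {fset I}) (B : I -> set nat) l g y :
  mutually_independent Y ->
  (forall i n, Q (Y i @^-1` [set n]) = (lam i n)%:E) ->
  uniq l -> (forall i, i \in l -> i \notin J) ->
  (forall z, 0 <= g z) ->
  \int[Q]_(w in \bigcap_(i in [set` J]) (Y i @^-1` B i))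
     g (overwrite l (Y ^~ w) y) =
  Q (\bigcap_(i in [set` J]) (Y i @^-1` B i)) * expect lam l g y.
Proof.
move=> indY lamE + + g0.
have lam0 i n : (0 <= lam i n)%R by rewrite -lee_fin -lamE measure_ge0.
have mcap (K : {fset I}) (C : I -> set nat) :
    measurable (\bigcap_(i in [set` K]) (Y i @^-1` C i)).
  apply: fin_bigcap_measurable => [|i _]; first exact: finite_fset.
  by rewrite -[X in measurable X]setTI; exact: measurable_funPT.
elim: l J B y => [|i l IH] J B y /=.
  move=> _ _; rewrite (eq_integral (cst (g y))).
    by rewrite integral_cst// muleC.
  by move=> w _; congr g; apply/funext => j.
move=> /andP[il ul] lJ; rewrite (integral_fibers (Y i))//; last first.
  exact: measurable_overwrite.
set A := \bigcap_(_ in _) _.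
have iJ : i \notin J by rewrite lJ ?mem_head.
have indep n : A `&` Y i @^-1` [set n] =
   \bigcap_(j in [set` (i |` J)%fset]) (Y j @^-1` (if j == i then [set n] else B j)).
  rewrite set_fsetU1 bigcap_setU1 eqxx setIC; congr setI.
  apply: eq_bigcapr => j /= jJ; case: eqP => // ji.
  by rewrite -ji jJ in iJ.
have QAi n : Q (A `&` Y i @^-1` [set n]) = Q A * (lam i n)%:E.
  rewrite indep indY// big_fsetU1//= eqxx lamE /A indY// muleC; congr mule.
  rewrite big_seq [RHS]big_seq; apply: eq_bigr => j jJ; case: eqP => // ji.
  by rewrite -ji jJ in iJ.
have QAfin : Q A = (fine (Q A))%:E by rewrite fineK// fin_num_measure//; exact: mcap.
rewrite QAfin -nneseriesZl; last first.
  by move=> *; rewrite mule_ge0 ?lee_fin ?expect_ge0.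
apply: eq_eseriesr => n _; rewrite muleA -QAfin -QAi.
rewrite [in RHS]indep -IH//; last first.
  move=> j jl; rewrite !inE negb_or lJ ?inE ?jl ?orbT// andbT.
  by apply: contraNneq il => <-.
rewrite -indep; apply: eq_integral => w.
by rewrite inE => -[_ /= Yin]; rewrite overwrite_cons Yin.
Qed.

End CoordinateLaws.

(** * Convex interpolation of a sequence *)

Section ConvexInterpolation.
Variables (R : realType) (h : nat -> R).
Hypothesis h_nd : forall n, h n <= h n.+1.
Hypothesis h_convex : forall n, h n.+1 + h n.+1 <= h n + h n.+2.

Let chord k x : R := h k + (x - k%:R) * (h k.+1 - h k).

Let chord_nd k x y : x <= y -> chord k x <= chord k y.
Proof. by move=> xy; have := h_nd k; rewrite /chord; nra. Qed.

Let slope_nd m j : h m.+1 - h m <= h (m + j).+1 - h (m + j)%N.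
Proof.
elim: j => [|j IH]; first by rewrite addn0.
by rewrite addnS; have := h_convex (m + j); lra.
Qed.

(** Increments of [h] are nondecreasing, so the line through two consecutive points, extended either
    way, stays below the graph at integers. *)
Let chord_le k n : chord k n%:R <= h n.
Proof.
rewrite /chord; have [kn|/ltnW nk] := leqP k n.
  rewrite -(subnKC kn) natrD addrAC subrr add0r; elim: (n - k)%N => [|j IH].
    by rewrite mul0r addn0 addr0.
  by rewrite addnS -natr1; have := slope_nd k j; lra.
rewrite -(subnKC nk) natrD opprD addrA subrr add0r; elim: (k - n)%N => [|j IH].
  by rewrite oppr0 mul0r addn0 addr0.
have := slope_nd (n + j) 1; rewrite addn1 addnS -natr1 => sl.
have j0 : 0 <= j%:R :> R by [].
by nra.
Qed.

(** A supremum of nondecreasing affine functions is nondecreasing and convex at once; at the integer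
    [n] it is attained by [chord n]. *)
Let interpolant x := sup (range (chord ^~ x)).

Let chord_has_sup x : has_sup (range (chord ^~ x)).
Proof.
split; first by exists (chord 0 x), 0%N.
(* [(Num.trunc x).+1] exceeds [x], and [chord_le] bounds all chords there. *)
exists (h (Num.trunc x).+1) => _ [k _ <-].
apply: le_trans (chord_le k _); apply: chord_nd.
by rewrite ltW// truncnS_gt.
Qed.

Let chord_le_interpolant k x : chord k x <= interpolant x.
Proof. by apply: ub_le_sup; [case: (chord_has_sup x)|exists k]. Qed.

Let interpolant_le x c : (forall k, chord k x <= c) -> interpolant x <= c.
Proof.
move=> H; apply: ge_sup; first by case: (chord_has_sup x).
by move=> _ [k _ <-].
Qed.

(** The order tests functions of a real variable, whereas the recursion yields test functions on the
    integers only. *)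
Lemma convex_interpolation : exists phi : R -> R,
  [/\ {homo phi : x y / x <= y},
      convex_function (`[0, +oo[%classic : set R) phi &
      forall n, phi n%:R = h n].
Proof.
exists interpolant; split.
- move=> x y xy; apply: interpolant_le => k.
  by apply: le_trans (chord_le_interpolant k y); exact: chord_nd.
- move=> t x y _ _; rewrite !convRE; apply: interpolant_le => k.
  have := chord_le_interpolant k x; have := chord_le_interpolant k y.
  set a := interpolant x; set b := interpolant y => yb xa.
  have t0 : 0 <= t%:num by [].
  have t1 : 0 <= unstable.onem t%:num by rewrite subr_ge0.
  apply: le_trans (lerD (ler_wpM2l t0 xa) (ler_wpM2l t1 yb)).
  suff /(_ t%:num x y) -> : forall p x' y' : R, chord k (p * x' + (1 - p) * y') =
      p * chord k x' + (1 - p) * chord k y' by [].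
  by move=> p x' y'; rewrite /chord; ring.
- move=> n; apply/le_anti/andP; split; first exact: interpolant_le.
  apply: le_trans (chord_le_interpolant n _).
  by rewrite /chord subrr mul0r addr0.
Qed.

End ConvexInterpolation.

(** * Limits along nondecreasing integer sequences *)

Section Extension.
Variables (R : realType) (phi : R -> R).
Hypothesis phi_nd : {in `[0, +oo[ &, {homo phi : x y / x <= y}}.

Lemma cvg_extend_pinfty :
  ((phi x)%:E @[x --> +oo%R] --> extend phi +oo)%E.
Proof.
suff : cvg ((phi x)%:E @[x --> +oo%R]) by [].
(* [phi] is monotone only on [[0, +oo[]; composing with max(x, 0) gives a globally monotone function
   equal to it near +oo. *)
have nd : nondecreasing_fun (fun x => (phi (Num.max x 0))%:E).
  move=> x y xy; rewrite lee_fin.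
  apply: phi_nd; last by rewrite ge_max !le_max xy lexx !orbT.
    by rewrite in_itv/= le_max lexx orbT.
  by rewrite in_itv/= le_max lexx orbT.
have /cvg_ex[l cl] := nondecreasing_is_cvge nd.
apply/cvg_ex; exists l; apply: cvg_trans cl; apply: near_eq_cvg.
near=> x; rewrite max_l//; near: x; exact: nbhs_pinfty_ge.
Unshelve. all: by end_near. Qed.

(** A bounded nondecreasing sequence of naturals is eventually constant; an unbounded one tends to
    +oo, where [extend] is the limit of [phi]. *)
Lemma cvg_extend (a : nat -> nat) (u : \bar R) :
  {homo a : m n / (m <= n)%N} ->
  (a n)%:R%:E @[n --> \oo] --> u ->
  (phi (a n)%:R)%:E @[n --> \oo] --> extend phi u.
Proof.
move=> a_nd au.
have [[N aN]|unb] := pselect (exists N, forall n, (a n <= N)%N).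
  pose hit := fun j => `[< exists n, a n = j >].
  have hit0 : exists j, hit j by exists (a 0%N); apply/asboolP; exists 0%N.
  have hitN j : hit j -> (j <= N)%N by move=> /asboolP[n <-].
  have [_ /asboolP[m <-] maxm] := ex_maxnP hit0 hitN.
  have am n : (m <= n)%N -> a n = a m.
    move=> mn; apply/eqP; rewrite eqn_leq (a_nd _ _ mn) andbT.
    by apply: maxm; apply/asboolP; exists n.
  have cst_cvg (V : topologicalType) (F : nat -> V) :
      F (a n) @[n --> \oo] --> F (a m).
    by apply: cvg_near_cst; exists m => // n /= mn; rewrite am.
  rewrite -(cvg_unique _ (cst_cvg _ (fun j => (j%:R : R)%:E)) au)//=.
  exact: (cst_cvg _ (fun j => (phi j%:R)%:E)).
have a_oo : a n @[n --> \oo] --> \oo.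
  apply/cvgnyPge => N.
  have [n Nn] : exists n, (N <= a n)%N.
    apply: contrapT => H; apply: unb; exists N => n.
    by rewrite leqNgt; apply/negP => /ltnW Nn; apply: H; exists n.
  by exists n => // k /= nk; exact: leq_trans (a_nd _ _ nk).
have /cvgenyP a_ooe := a_oo.
rewrite -(cvg_unique _ (a_ooe R) au)//.
by apply: cvg_comp cvg_extend_pinfty; apply/cvgrnyP.
Qed.

End Extension.

(** * Monotone convergence with a lower bound other than 0 *)

Section ShiftedIntegral.
Context (R : realType) d (S : measurableType d) (Q : probability S R).
Local Open Scope ereal_scope.

Lemma integral_shift (c : R) (g : S -> \bar R) :
  measurable_fun setT g -> (forall w, 0 <= g w) ->
  \int[Q]_w (c%:E + g w) = c%:E + \int[Q]_w g w.
Proof.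
move=> mg g0.
have intc (r : R) : \int[Q]_w (cst r%:E w) = r%:E.
  by rewrite integral_cst//= probability_setT mule1.
have [gfin|] := ltP (\int[Q]_w g w) +oo.
  rewrite integralD//; first by rewrite intc.
    exact: finite_measure_integrable_cst.
  apply/integrableP; split => //.
  by under eq_integral do rewrite gee0_abs//.
rewrite leye_eq => /eqP goo; rewrite goo addey//.
have mf : measurable_fun setT (fun w => c%:E + g w).
  by apply: emeasurable_funD => //; exact: measurable_cst.
set f := (fun w => c%:E + g w) in mf *.
have negfin : \int[Q]_w f^\- w <= `|c|%:E.
  rewrite -[leRHS]intc; apply: ge0_le_integral => //.
  - exact: measurable_funeneg.
  - move=> w _ /=; rewrite funenegE ge_max lee_fin normr_ge0 andbT.
    rewrite leeNl; apply: le_trans (_ : c%:E <= _).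
      by rewrite -EFinN lee_fin lerNl -normrN ler_norm.
    by rewrite leeDl.
have posoo : \int[Q]_w f^\+ w = +oo.
  have : +oo <= \int[Q]_w f^\+ w + `|c|%:E.
    rewrite -goo -[in leRHS](intc `|c|%R) -ge0_integralD//;
      [|exact: measurable_funepos|by move=> w _; rewrite lee_fin].
    apply: ge0_le_integral => //.
      by apply: emeasurable_funD => //; exact: measurable_funepos.
    move=> w _ /=.
    apply: (@le_trans _ _ (f w + `|c|%:E)); last first.
      by rewrite leeD2r// funeposE le_max lexx.
    rewrite /f addeAC -EFinD leeDr// lee_fin -lerBlDl sub0r -normrN.
    by rewrite ler_norm.
  by rewrite leye_eq; case: (\int[Q]_w f^\+ w) => // r /eqP.
by rewrite integralE posoo; case: (\int[Q]_w f^\- w) negfin.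
Qed.

(** Monotone convergence applies to phi - phi 0, which is nonnegative on the naturals;
    [integral_shift] restores the constant. *)
Lemma integral_extend (phi : R -> R) (a : nat -> S -> nat) (u : S -> \bar R) :
  {in `[0, +oo[%R &, {homo phi : x y / x <= y}%R} ->
  (forall n, measurable_fun setT (a n)) ->
  (forall w, {homo a ^~ w : m n / (m <= n)%N}) ->
  (forall w, (a n w)%:R%:E @[n --> \oo] --> u w) ->
  (phi 0%R)%:E + \int[Q]_w (phi (a n w)%:R - phi 0)%:E @[n --> \oo] -->
  \int[Q]_w extend phi (u w).
Proof.
move=> phi_nd ma a_nd au.
pose psi (k : nat) := (phi k%:R - phi 0)%:E.
have psi_nd m n : (m <= n)%N -> psi m <= psi n.
  by move=> mn; rewrite lee_fin lerB// phi_nd ?in_itv/= ?andbT ?ler_nat// ler0n.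
have psi0 n : 0 <= psi n by rewrite (le_trans _ (psi_nd _ _ (leq0n n)))// lee_fin subrr.
have mpsi n : measurable_fun setT (fun w => psi (a n w)).
  exact: (measurableT_comp (f := psi)).
have psia_nd w : nondecreasing_seq (fun n => psi (a n w)).
  by move=> m n mn; apply: psi_nd; exact: a_nd.
have psi_cvg w := ereal_nondecreasing_is_cvgn (psia_nd w).
suff -> : \int[Q]_w extend phi (u w) =
    \int[Q]_w ((phi 0)%:E + limn (fun n => psi (a n w))).
  rewrite integral_shift.
  - apply: cvgeD; [exact: fin_num_adde_defr|exact: cvg_cst|].
    by apply: (@cvg_monotone_convergence _ _ _ Q _ measurableT (fun n w => psi (a n w))).
  - exact: (emeasurable_fun_cvg (fun n w => psi (a n w))).
  - by move=> w; apply: lime_ge => //; exact: nearW.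
apply: eq_integral => w _.
apply: (cvg_unique _ (cvg_extend phi_nd (a_nd w) (au w))) => //.
rewrite (_ : (fun n => _) = (fun n => (phi 0)%:E + psi (a n w))).
  by apply: cvgeD; [exact: fin_num_adde_defr|exact: cvg_cst|exact: psi_cvg].
by apply/funext => n; rewrite -EFinD addrC subrK.
Qed.

End ShiftedIntegral.

(** * From truncated arrivals to total arrivals *)

Lemma cvg_arrivals (R : realType) xi eta tie :
  (forall v n, (tie v n <= n)%N) ->
  ((arrivals (truncate n xi) eta n [::])%:R%:E : \bar R) @[n --> \oo] -->
  total_arrivals R xi eta tie.
Proof.
move=> tie_range.
pose b t : \bar R := (arrivals xi eta t [::])%:R%:E.
pose a n : \bar R := (arrivals (truncate n xi) eta n [::])%:R%:E.
have b_nd : nondecreasing_seq b.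
  by move=> s t st; rewrite lee_fin ler_nat; exact: arrivals_monotone.
have a_nd : nondecreasing_seq a.
  move=> s t st; rewrite lee_fin ler_nat; apply: arrivals_monotone => // v.
  exact: truncate_monotone.
have root : tree xi [::] by apply/forallP => -[].
suff -> : total_arrivals R xi eta tie = ereal_sup (range a).
  exact: ereal_nondecreasing_cvgn a_nd.
transitivity (ereal_sup (range b)).
  (* Shift by one: X_t sums the arrivals at times below t + 1. *)
  apply: cvg_lim => //; rewrite -cvg_shiftS.
  apply: cvg_trans (ereal_nondecreasing_cvgn b_nd); apply: near_eq_cvg.
  by apply: nearW => t /=; rewrite sumEFin -natr_sum parking_arrivals.
apply/le_anti/andP; split; apply: ge_ereal_sup => _ [t _ <-].
  have [K0 HK0] := arrivals_truncate xi eta t [::].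
  (* [maxn K0 t] is at least the cap needed for X_t and at least the time [t]. *)
  apply: le_trans (ereal_sup_ubound (ex_intro2 _ _ (maxn K0 t) I erefl)).
  rewrite lee_fin ler_nat -(HK0 (maxn K0 t)) ?leq_maxl//.
  by apply: arrivals_monotone => //; exact: leq_maxr.
apply: le_trans (ereal_sup_ubound (ex_intro2 _ _ t I erefl)).
by rewrite lee_fin ler_nat; apply: arrivals_monotone => // v; exact: truncate_le.
Qed.

(** * The increasing convex order on integers *)

Section DiscreteOrder.
Context (R : realType) (d d' : measure_display).
Context (O : measurableType d) (P : probability O R) (eta : {RV P >-> nat}).
Context (O' : measurableType d') (P' : probability O' R) (eta' : {RV P' >-> nat}).
Local Open Scope ereal_scope.

(** The hypothesis on the laws in the form that [expect_le] takes for a single coordinate. *)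
Lemma icx_le_nat (h : nat -> R) :
  icx_le P P' (fun w => (eta w)%:R%:E) (fun w => (eta' w)%:R%:E) ->
  (forall n, 0 <= h n)%R -> (forall n, h n <= h n.+1)%R ->
  (forall n, h n.+1 + h n.+1 <= h n + h n.+2)%R ->
  \sum_(n <oo) P (eta @^-1` [set n]) * (h n)%:E <=
  \sum_(n <oo) P' (eta' @^-1` [set n]) * (h n)%:E.
Proof.
move=> le_eta h0 h_nd h_convex.
have [phi [phi_nd phi_convex phiE]] := convex_interpolation h_nd h_convex.
rewrite -!integral_nat_valued; [|by move=> n; rewrite lee_fin..].
rewrite (_ : h = fun n => phi n%:R); last exact/esym/funext.
exact: (le_eta phi (fun x y _ _ => @phi_nd x y) phi_convex).
Qed.

End DiscreteOrder.

(** a(n+1) is at most the midpoint of a(n) and a(n+2); monotonicity and convexity with weight 1/2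
    conclude. *)
Lemma convex_discrete_icx (R : realType) (phi : R -> R) (a : nat -> nat) :
  {in `[0, +oo[ &, {homo phi : x y / x <= y}} ->
  convex_function (`[0, +oo[%classic : set R) phi ->
  discrete_icx a ->
  forall n, phi (a n)%:R <= phi (a n.+1)%:R /\
    phi (a n.+1)%:R + phi (a n.+1)%:R <= phi (a n)%:R + phi (a n.+2)%:R.
Proof.
move=> phi_nd phi_convex a_icx n; have [a1 a2] := a_icx n.
have nat0 m : (m%:R : R) \in `[0, +oo[ by rewrite in_itv/= ler0n.
split; first by rewrite phi_nd// ler_nat.
have nat0' m : (m%:R : R) \in (`[0, +oo[%classic : set R).
  by rewrite inE; exact: nat0.
have half0 : 0 <= 2^-1 :> R by rewrite invr_ge0.
have half1 : 2^-1 <= 1 :> R by rewrite invf_le1// ler1n.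
have := phi_convex (Itv01 half0 half1) _ _ (nat0' (a n)) (nat0' (a n.+2)).
rewrite !convRE /= /unstable.onem => conv2.
have mid : phi (a n.+1)%:R <= phi (2^-1 * (a n)%:R + (1 - 2^-1) * (a n.+2)%:R).
  apply: phi_nd => //.
    by rewrite in_itv/= andbT; have := ler0n R (a n); have := ler0n R (a n.+2); lra.
  by move: a2; rewrite -(ler_nat R) !natrD; lra.
by lra.
Qed.

(** * Root arrivals as a function of finitely many labels *)

Definition label : Type := (vertex + vertex) + (vertex * nat).

Definition truncated_arrivals (n : nat) (y : label -> nat) : nat :=
  arrivals (truncate n (fun v => y (inl (inl v)))) (fun v => y (inl (inr v))) n [::].

(** Arrival counts do not read tie-breaking labels. [undup] gives the distinctness that [expect_le]
    asks for. *)
Definition relevant (n : nat) : seq label :=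
  undup ([seq inl (inl v) | v <- descendants n n [::]] ++
         [seq inl (inr v) | v <- descendants n n [::]]).

Lemma truncated_arrivals_overwrite n x y :
  truncated_arrivals n (overwrite (relevant n) x y) = truncated_arrivals n x.
Proof.
apply: arrivals_truncate_eq => v vD; rewrite /overwrite mem_undup mem_cat.
  by rewrite map_f.
by rewrite (map_f (fun v => inl (inr v)) vD) orbT.
Qed.

Lemma discrete_icx_truncated_arrivals n v y :
  discrete_icx (fun k => truncated_arrivals n (upd y (inl (inr v)) k)).
Proof.
(* Updating a car label leaves all offspring numbers unchanged. *)
apply: (@discrete_icx_arrivals (truncate n (fun u => y (inl (inl u))))
  (fun k u => upd y (inl (inr v)) k (inl (inr u)))).
by move=> u k; rewrite /upd; case: eqP => _; lia.
Qed.

(** * Expectations in the Galton-Watson model *)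

Section GaltonWatson.
Context (R : realType) (d : measure_display) (S : measurableType d).
Context (Q : probability S R) (mu nu : probability nat R).
Variable M : gw_parking Q mu nu.
Local Open Scope ereal_scope.

Definition coordinate (i : label) : {RV Q >-> nat} :=
  match i with
  | inl (inl v) => offspring M v
  | inl (inr v) => cars M v
  | inr (v, n) => tiebreak M v n
  end.

Definition pmf (i : label) (n : nat) : R := fine (Q (coordinate i @^-1` [set n])).

Lemma pmfE i n : Q (coordinate i @^-1` [set n]) = (pmf i n)%:E.
Proof. by rewrite fineK// fin_num_measure//; exact: measurable_fiber. Qed.

Lemma pmf_ge0 i n : (0 <= pmf i n)%R.
Proof. by rewrite -lee_fin -pmfE measure_ge0. Qed.

Lemma expectation_truncated_arrivals (psi : nat -> \bar R) n :
  (forall k, 0 <= psi k) ->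
  \int[Q]_w psi (truncated_arrivals n (coordinate ^~ w)) =
  expect pmf (relevant n) (psi \o truncated_arrivals n) (fun=> 0%N).
Proof.
move=> psi0.
have := @integral_independent R label d S Q (coordinate) pmf fset0
  (fun=> setT) (relevant n) (psi \o truncated_arrivals n) (fun=> 0%N)
  (gw_independent M) pmfE (undup_uniq _).
rewrite set_fset0 bigcap_set0 probability_setT mul1e => <- //=.
by under [RHS]eq_integral do rewrite truncated_arrivals_overwrite.
Qed.

Lemma measurable_truncated_arrivals n :
  measurable_fun setT (fun w => truncated_arrivals n (coordinate ^~ w)).
Proof.
under eq_fun do rewrite -(truncated_arrivals_overwrite _ _ (fun=> 0%N)).
exact: measurable_overwrite.
Qed.

(** The approximating iterated expectations depend on the model only through [pmf], so two models
    can be compared by their coordinate laws. *)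
Lemma cvg_expect_root_arrivals (phi : R -> R) :
  {in `[0, +oo[%R &, {homo phi : x y / x <= y}%R} ->
  (phi 0%R)%:E + expect pmf (relevant n)
    (fun y => (phi (truncated_arrivals n y)%:R - phi 0)%:E) (fun=> 0%N)
    @[n --> \oo] --> \int[Q]_w extend phi (root_arrivals M w).
Proof.
move=> phi_nd.
under eq_fun => n.
  rewrite -(@expectation_truncated_arrivals (fun k => (phi k%:R - phi 0)%:E));
    last by move=> k; rewrite lee_fin subr_ge0 phi_nd ?in_itv/= ?lexx ?ler0n.
  over.
apply: (@integral_extend _ _ _ _ _
  (fun n w => truncated_arrivals n (coordinate ^~ w)) _ phi_nd).
- exact: measurable_truncated_arrivals.
- move=> w m n mn; apply: (@leq_trans
      (arrivals (truncate n (offspring M ^~ w)) (cars M ^~ w) m [::])).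
    by apply: arrivals_monotone => // v; exact: truncate_monotone.
  exact: arrivals_monotone.
- by move=> w; apply: cvg_arrivals => v n; exact: tiebreak_range.
Qed.

End GaltonWatson.

(** * Replacing the law of the cars, then passing to the limit *)

Theorem theorem7 (R : realType)
  (d0 d0' d d' : measure_display)
  (O : measurableType d0) (P : probability O R) (eta : {RV P >-> nat})
  (O' : measurableType d0') (P' : probability O' R) (eta' : {RV P' >-> nat})
  (mu : probability nat R)
  (S : measurableType d) (Q : probability S R)
  (M : gw_parking Q mu (distribution P eta))
  (S' : measurableType d') (Q' : probability S' R)
  (M' : gw_parking Q' mu (distribution P' eta')) :
  icx_le P P' (fun w => (eta w)%:R%:E) (fun w => (eta' w)%:R%:E) ->
  icx_le Q Q' (root_arrivals M) (root_arrivals M').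
Proof.
move=> le_eta phi phi_nd phi_convex.
set y0 : label -> nat := fun=> 0%N.
(* Subtracting phi 0 makes the integrand nonnegative, as [expect_le] asks. *)
pose g n (y : label -> nat) := (phi (truncated_arrivals n y)%:R - phi 0)%:E.
have g0 n y : (0 <= g n y)%E.
  by rewrite lee_fin subr_ge0 phi_nd ?in_itv/= ?lexx ?ler0n.
have step n : (expect (pmf M) (relevant n) (g n) y0 <=
    expect (pmf M') (relevant n) (g n) y0)%E.
  apply: expect_le => //; [exact: undup_uniq|exact: pmf_ge0|exact: pmf_ge0|].
  move=> i z; rewrite mem_undup mem_cat => /orP[] /mapP[v _ ->].
    (* Offspring labels have law [mu] in both models, so the two sums agree. *)
    under eq_eseriesr do rewrite -pmfE.
    under [leRHS]eq_eseriesr do rewrite -pmfE.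
    under eq_eseriesr => k _ do rewrite [Q _](offspring_law M v).
    under [leRHS]eq_eseriesr => k _ do rewrite [Q' _](offspring_law M' v).
    by [].
  (* Car labels: here the hypothesis on [eta] and [eta'] enters. *)
  under eq_eseriesr do rewrite -pmfE.
  under [leRHS]eq_eseriesr do rewrite -pmfE.
  under eq_eseriesr => k _ do rewrite [Q _](cars_law M v).
  under [leRHS]eq_eseriesr => k _ do rewrite [Q' _](cars_law M' v).
  have icx := convex_discrete_icx phi_nd phi_convex
    (discrete_icx_truncated_arrivals n v z).
  apply: (@icx_le_nat _ _ _ _ _ _ _ _ _ (fun k =>
    phi (truncated_arrivals n (upd z (inl (inr v)) k))%:R - phi 0)) => // k.
  - by rewrite -lee_fin; exact: g0.
  - by rewrite lerB//; case: (icx k).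
  - by case: (icx k) => _; lra.
have cM := @cvg_expect_root_arrivals _ _ _ _ _ _ M _ phi_nd.
have cM' := @cvg_expect_root_arrivals _ _ _ _ _ _ M' _ phi_nd.
rewrite -(cvg_lim _ cM)// -(cvg_lim _ cM')//; apply: lee_lim.
- exact: cvgP cM.
- exact: cvgP cM'.
- by apply: nearW => n; rewrite leeD2l// step.
Qed.
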